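(* Let $L_1\subset\mathbb H$ be a rank-4 lattice and let $\{v_1,v_2,v_3,v_4\}$ be a basis of $L_1$. Then $\{v_1,v_2,v_3,v_4\}$ is equivalent to a special basis $\{1,\omega_2,\omega_3,\omega_4\}$ of a rank-4 lattice $L_2$. As a consequence $L_1=\mathbb Zv_1+\mathbb Zv_2+\mathbb Zv_3+\mathbb Zv_4$ and $L_2=\mathbb Z+\mathbb Z\omega_2+\mathbb Z\omega_3+\mathbb Z\omega_4$ are equivalent, and hence they generate equivalent tori $\mathbb H/L_1$ and $\mathbb H/L_2$.
   Context: $\mathbb H\cong\mathbb R^4$ is the skew field of quaternions with its Euclidean scalar product $\langle\cdot,\cdot\rangle$, and $\mathbb S=\{q\in\mathbb H: q^2=-1\}$. A function $f:\Omega\to\mathbb H$ on a domain $\Omega\subseteq\mathbb H$ is (slice) regular if for every $I\in\mathbb S$ its restriction $f_I$ to $\Omega\cap(\mathbb R+I\mathbb R)$ has continuous derivatives and $\frac12\left(\frac{\partial}{\partial x}+I\frac{\partial}{\partial y}\right)f_I(x+Iy)=0$. A rank-4 lattice in $\mathbb H$ is the additive subgroup generated by four $\mathbb R$-linearly independent elements (a basis of the lattice). A quaternionic torus is a quotient $T=\mathbb H/L$, $L$ a rank-4 lattice, with the atlas of local inverses of the projection $\pi:\mathbb H\to\mathbb H/L$ on small connected open sets. A map between two quaternionic tori is regular if its expressions in these charts are slice regular; a biregular diffeomorphism is a bijective regular map with regular inverse. Two tori are equivalent if there is a biregular diffeomorphism of one onto the other. Two lattices are equivalent if the tori they generate are equivalent.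 A basis $\{\omega_1,\dots,\omega_4\}$ of a rank-4 lattice and a basis $\{\alpha_1,\dots,\alpha_4\}$ of a rank-4 lattice are equivalent if the two lattices are equivalent, i.e. if there exist $a\in\mathbb H\setminus\{0\}$ and $A\in GL(4,\mathbb Z)$ (integer matrices of determinant $\pm1$) with $A\,{}^t(\omega_1,\omega_2,\omega_3,\omega_4)={}^t(\alpha_1a,\alpha_2a,\alpha_3a,\alpha_4a)$. The Gram matrix of an (ordered) basis $\{v_1,v_2,v_3,v_4\}$ is $(\langle v_i,v_j\rangle)_{i,j}$. A Gram matrix $R=(r_{i,j})$ is reduced (in the sense of Minkowski–Siegel) if and only if: B1) $r_{k,k+1}\ge 0$ for $k=1,2,3$; B2) for each $k=1,2,3,4$, $n R\,{}^tn\ge r_{k,k}$ for every $n=(n_1,n_2,n_3,n_4)\in\mathbb Z^4$ such that $\gcd(n_k,\dots,n_4)=1$. A basis of a lattice is reduced if its Gram matrix is reduced, and a special basis is a reduced basis whose first element is $1$. *)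

(* Defs.v *)
From HB Require Import structures.
From mathcomp Require Import all_boot all_order all_algebra.
From mathcomp Require Import generic_quotient ring_quotient.
From mathcomp Require Import all_classical all_reals all_analysis.
From mathcomp Require Import ring.
Set Implicit Arguments.
Unset Strict Implicit.
Unset Printing Implicit Defensive.
Import Order.TTheory GRing.Theory Num.Theory.
Import numFieldNormedType.Exports.

Local Open Scope classical_set_scope.
Local Open Scope ring_scope.
Local Open Scope quotient_scope.

(* The coordinates of [q] in the basis 1, i, j, k are [q 0 0], ..., [q 0 3].
   The norm [`|q|] inherited from row vectors is the sup norm; it is only used
   for the topology and for derivatives.  The Euclidean structure is [qdot]. *)
Definition quat (R : realType) : Type := 'rV[R]_4.

HB.instance Definition _ (R : realType) := NormedModule.copy (quat R) 'rV[R]_4.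
HB.instance Definition _ (R : realType) := Complete.copy (quat R) 'rV[R]_4.
HB.instance Definition _ (R : realType) :=
  Vector.copy (quat R) 'rV[R]_4.

Definition quat_of (R : realType) (a b c d : R) : quat R :=
  \row_(m < 4) [:: a; b; c; d]`_m.

Definition qone (R : realType) : quat R := quat_of 1 0 0 0.

Definition qmul (R : realType) (p q : quat R) : quat R :=
  let a m := p 0 m in let b m := q 0 m in
  quat_of (a 0 * b 0 - a 1 * b 1 - a 2%:R * b 2%:R - a 3%:R * b 3%:R)
          (a 0 * b 1 + a 1 * b 0 + a 2%:R * b 3%:R - a 3%:R * b 2%:R)
          (a 0 * b 2%:R - a 1 * b 3%:R + a 2%:R * b 0 + a 3%:R * b 1)
          (a 0 * b 3%:R + a 1 * b 2%:R - a 2%:R * b 1 + a 3%:R * b 0).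

Definition qdot (R : realType) (p q : quat R) : R :=
  \sum_(m < 4) p 0 m * q 0 m.

Definition qinv (R : realType) (q : quat R) : quat R :=
  (qdot q q)^-1 *: quat_of (q 0 0) (- q 0 1) (- q 0 2%:R) (- q 0 3%:R).

Lemma quat_eqP (R : realType) (p q : quat R) :
  p 0 0 = q 0 0 -> p 0 1 = q 0 1 -> p 0 2%:R = q 0 2%:R ->
  p 0 3%:R = q 0 3%:R -> p = q.
Proof.
move=> h0 h1 h2 h3; apply/rowP; case=> [[|[|[|[|//]]]] hm].
- by rewrite (_ : Ordinal hm = 0) //; apply: val_inj.
- by rewrite (_ : Ordinal hm = 1) //; apply: val_inj.
- by rewrite (_ : Ordinal hm = 2%:R) //; apply: val_inj.
- by rewrite (_ : Ordinal hm = 3%:R) //; apply: val_inj.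
Qed.

Lemma quat_ofE (R : realType) (a b c d : R) :
  (quat_of a b c d 0 0 = a) * (quat_of a b c d 0 1 = b) *
  (quat_of a b c d 0 2%:R = c) * (quat_of a b c d 0 3%:R = d).
Proof. by rewrite /quat_of !mxE. Qed.

Lemma qdotE (R : realType) (p q : quat R) :
  qdot p q = p 0 0 * q 0 0 + p 0 1 * q 0 1
             + p 0 2%:R * q 0 2%:R + p 0 3%:R * q 0 3%:R.
Proof.
rewrite /qdot !big_ord_recr big_ord0 /= add0r.
by do 3?[congr (_ + _)]; congr (p 0 _ * q 0 _); apply: val_inj.
Qed.

Lemma qmulA (R : realType) : associative (@qmul R).
Proof.
by move=> p q r; apply: quat_eqP; rewrite /qmul !quat_ofE; ring.
Qed.

Lemma qmul1l (R : realType) : left_id (@qone R) (@qmul R).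
Proof.
by move=> q; apply: quat_eqP; rewrite /qmul /qone !quat_ofE; ring.
Qed.

Lemma qmul1r (R : realType) : right_id (@qone R) (@qmul R).
Proof.
by move=> q; apply: quat_eqP; rewrite /qmul /qone !quat_ofE; ring.
Qed.

Lemma qmulDl (R : realType) : left_distributive (@qmul R) +%R.
Proof.
by move=> p q r; apply: quat_eqP; rewrite [RHS]mxE /qmul !quat_ofE !mxE; ring.
Qed.

Lemma qmulDr (R : realType) : right_distributive (@qmul R) +%R.
Proof.
by move=> p q r; apply: quat_eqP; rewrite [RHS]mxE /qmul !quat_ofE !mxE; ring.
Qed.

Lemma qone_neq0 (R : realType) : qone R != 0.
Proof.
by apply/eqP => /rowP/(_ 0)/eqP; rewrite /qone quat_ofE mxE oner_eq0.
Qed.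

HB.instance Definition _ (R : realType) :=
  GRing.Zmodule_isNzRing.Build (quat R)
    (@qmulA R) (@qmul1l R) (@qmul1r R) (@qmulDl R) (@qmulDr R) (@qone_neq0 R).

Lemma qmulE (R : realType) (p q : quat R) : p * q = qmul p q.
Proof. by []. Qed.

Lemma qoneE (R : realType) : 1 = qone R.
Proof. by []. Qed.

Lemma qmulZl (R : realType) (a : R) (p q : quat R) :
  a *: (p * q) = (a *: p) * q.
Proof.
by apply: quat_eqP; rewrite !qmulE [LHS]mxE /qmul !quat_ofE !mxE; ring.
Qed.

Lemma qmulZr (R : realType) (a : R) (p q : quat R) :
  a *: (p * q) = p * (a *: q).
Proof.
by apply: quat_eqP; rewrite !qmulE [LHS]mxE /qmul !quat_ofE !mxE; ring.
Qed.

HB.instance Definition _ (R : realType) :=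
  GRing.Lmodule_isLalgebra.Build R (quat R) (@qmulZl R).
HB.instance Definition _ (R : realType) :=
  GRing.Lalgebra_isAlgebra.Build R (quat R) (@qmulZr R).

Lemma qdot_eq0 (R : realType) (q : quat R) : (qdot q q == 0) = (q == 0).
Proof.
apply/idP/eqP => [|->]; last first.
  by rewrite /qdot big1 // => m _; rewrite mxE mul0r.
rewrite /qdot psumr_eq0 => [/allP h|m _]; last exact: sqr_ge0.
apply/rowP => m; rewrite mxE; apply/eqP.
by have := h m (mem_index_enum _); rewrite mulf_eq0 orbb.
Qed.

Lemma scale_quat_of (R : realType) (x a b c d : R) :
  x *: quat_of a b c d = quat_of (x * a) (x * b) (x * c) (x * d).
Proof. by apply: quat_eqP; rewrite mxE !quat_ofE. Qed.

Lemma qmulVr (R : realType) :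
  {in [pred q : quat R | q != 0], left_inverse 1 (@qinv R) *%R}.
Proof.
move=> q; rewrite inE -qdot_eq0 qdotE => q0.
by apply: quat_eqP; rewrite qmulE qoneE /qmul /qone /qinv qdotE scale_quat_of;
  rewrite !quat_ofE; field.
Qed.

Lemma qdivrr (R : realType) :
  {in [pred q : quat R | q != 0], right_inverse 1 (@qinv R) *%R}.
Proof.
move=> q; rewrite inE -qdot_eq0 qdotE => q0.
by apply: quat_eqP; rewrite qmulE qoneE /qmul /qone /qinv qdotE scale_quat_of;
  rewrite !quat_ofE; field.
Qed.

Lemma qunitP (R : realType) (p q : quat R) :
  q * p = 1 /\ p * q = 1 -> [pred q : quat R | q != 0] p.
Proof.
move=> [h _] /=; apply/eqP => p0.
by move/eqP: h; rewrite p0 mulr0 eq_sym oner_eq0.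
Qed.

Lemma qinv_out (R : realType) :
  {in [predC [pred q : quat R | q != 0]], @qinv R =1 id}.
Proof.
move=> q; rewrite !inE negbK => /eqP ->.
by rewrite /qinv (_ : qdot 0 0 = 0) ?invr0 ?scale0r //; apply/eqP; rewrite qdot_eq0.
Qed.

HB.instance Definition _ (R : realType) :=
  GRing.NzRing_hasMulInverse.Build (quat R)
    (@qmulVr R) (@qdivrr R) (@qunitP R) (@qinv_out R).

Definition imag_unit (R : realType) : set (quat R) := [set q | q ^+ 2 = -1].

(* [slice_pt I (x, y)] is the point x + I y. *)
Definition slice_pt (R : realType) (I : quat R) (z : R * R) : quat R :=
  z.1%:A + I * z.2%:A.

(* Meant for [Om] open, so that partial derivatives and their continuity at a
   point of the slice do not depend on the values of [f] outside [Om]. *)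
Definition slice_regular (R : realType) (Om : set (quat R))
    (f : quat R -> quat R) : Prop :=
  forall I, imag_unit I ->
  let fI := f \o slice_pt I in
  let dx := 'D_(1, 0) fI in
  let dy := 'D_(0, 1) fI in
  forall z : R * R, Om (slice_pt I z) ->
    [/\ derivable fI z (1, 0) /\ derivable fI z (0, 1),
        {for z, continuous dx}, {for z, continuous dy} &
        2^-1 *: (dx z + I * dy z) = 0].

Definition lattice_span (R : realType) (v : 'I_4 -> quat R) : set (quat R) :=
  [set q | exists n : 'I_4 -> int, q = \sum_(i < 4) v i *~ n i].

Definition is_basis (R : realType) (L : set (quat R)) (v : 'I_4 -> quat R) :=
  free [tuple v i | i < 4] /\ L = lattice_span v.

Record lattice (R : realType) : Type := Lattice {
  lattice_set :> set (quat R);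
  lattice_hasBasis : exists v : 'I_4 -> quat R, is_basis lattice_set v
}.

Definition lattice_mem (R : realType) (L : lattice R) : {pred quat R} :=
  fun q => `[< lattice_set L q >].

Lemma lattice_zmod_closed (R : realType) (L : lattice R) :
  zmod_closed (lattice_mem L).
Proof.
have [v [_ Lv]] := lattice_hasBasis L.
split=> [|p q /asboolP + /asboolP]; last first.
  rewrite Lv => -[m ->] [n ->]; apply/asboolP; rewrite Lv.
  exists (fun i => m i - n i); rewrite -sumrB.
  by apply: eq_bigr => i _; rewrite mulrzBr.
apply/asboolP; rewrite Lv; exists (fun=> 0).
by rewrite big1 // => i _; rewrite mulr0z.
Qed.

HB.instance Definition _ (R : realType) (L : lattice R) :=
  GRing.isZmodClosed.Build (quat R) (lattice_mem L) (lattice_zmod_closed L).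

Definition torus (R : realType) (L : lattice R) : Type :=
  quotient_topology (ring_quotient.Quotient.quot (lattice_mem L)).

HB.instance Definition _ (R : realType) (L : lattice R) :=
  Topological.on (torus L).
HB.instance Definition _ (R : realType) (L : lattice R) :=
  Quotient.on (torus L).

Definition torus_proj (R : realType) (L : lattice R) : quat R -> torus L :=
  \pi_(torus L).

(* Charts are indexed by their images: the open connected sets [U] on which
   the projection is injective (the "small" ones). *)
Definition chart_dom (R : realType) (L : lattice R) (U : set (quat R)) :=
  [/\ open U, connected U & set_inj U (torus_proj L)].

(* The local inverse of the projection with values in [U]; it is meaningful on
   [torus_proj L @` U] only. *)
Definition chart (R : realType) (L : lattice R) (U : set (quat R)) :
    torus L -> quat R :=
  'pinv_(fun=> 0) U (torus_proj L).

(* The expression of [F] in the charts given by [U] and [V] is the map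
   [q |-> chart V (F (torus_proj L1 q))] on the open set of those [q] in [U]
   with [F (torus_proj L1 q)] in the domain of the chart given by [V]. *)
Definition torus_regular (R : realType) (L1 L2 : lattice R)
    (F : torus L1 -> torus L2) : Prop :=
  continuous F /\
  forall U V : set (quat R), chart_dom L1 U -> chart_dom L2 V ->
    slice_regular
      (U `&` (F \o torus_proj L1) @^-1` (torus_proj L2 @` V))
      (chart V \o F \o torus_proj L1).

Definition biregular (R : realType) (L1 L2 : lattice R)
    (F : torus L1 -> torus L2) : Prop :=
  torus_regular F /\
  exists G : torus L2 -> torus L1,
    [/\ cancel F G, cancel G F & torus_regular G].

Definition tori_equiv (R : realType) (L1 L2 : lattice R) : Prop :=
  exists F : torus L1 -> torus L2, biregular F.

Definition lattice_equiv (R : realType) (L1 L2 : lattice R) : Prop :=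
  tori_equiv L1 L2.

Definition basis_equiv (R : realType) (omega alpha : 'I_4 -> quat R) : Prop :=
  exists (a : quat R) (A : 'M[int]_4),
    [/\ a != 0, A \in unitmx &
        forall i, \sum_(j < 4) omega j *~ A i j = alpha i * a].

Definition gram (R : realType) (v : 'I_4 -> quat R) : 'M[R]_4 :=
  \matrix_(i, j) qdot (v i) (v j).

(* Indices start from 0, and [x *m G *m x^T] is the 1 x 1 matrix n R n^t.
   The gcd of a family of integers is the gcd of their
   absolute values; it is 0 when they are all zero. *)
Definition minkowski_reduced (R : realType) (G : 'M[R]_4) : Prop :=
  (forall k l : 'I_4, l = k.+1 :> nat -> 0 <= G k l) /\
  (forall (k : 'I_4) (n : 'rV[int]_4),
     \big[gcdn/0%N]_(i < 4 | (k <= i)%N) absz (n 0 i) = 1%N ->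
     let x : 'rV[R]_4 := map_mx intr n in
     G k k <= (x *m G *m x^T) 0 0).

Definition special_basis (R : realType) (L : set (quat R))
    (w : 'I_4 -> quat R) : Prop :=
  [/\ is_basis L w, minkowski_reduced (gram w) & w ord0 = 1].

(* Main.v *)
Require Import Defs.
From mathcomp Require Import all_boot all_order all_algebra.
From mathcomp Require Import generic_quotient ring_quotient.
From mathcomp Require Import all_classical all_reals all_analysis.
From mathcomp Require Import ring lra zify.
Set Implicit Arguments.
Unset Strict Implicit.
Unset Printing Implicit Defensive.
Import Order.TTheory GRing.Theory Num.Theory.
Import numFieldNormedType.Exports.
Local Open Scope classical_set_scope.
Local Open Scope ring_scope.
Local Open Scope quotient_scope.

(** The lattice is reduced first, then rotated and rescaled.

    For a fixed basis [v], every other basis of the lattice is given by a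
    unimodular integer matrix, whose rows are the coordinates of the new basis
    vectors.  Rows are chosen greedily: each one is as short as possible among
    the rows that continue the previous ones to a unimodular matrix.  Minima
    exist since a ball contains finitely many lattice points
    ([combination_coercive], [coercive_min]).  Minkowski's condition B2 follows
    because an integer vector with coprime entries from the k-th one on, in the
    coordinates of the new basis, is itself a competitor for the k-th row; this
    is the completion of primitive vectors to unimodular matrices, read off the
    Smith normal form ([primitive_row_completion]).  Changing the signs of the
    basis vectors does not affect their lengths and achieves condition B1
    ([consecutive_signs]).

    If [u] is the reduced basis and [a] its first vector, right multiplication
    by the inverse of [a] is a Euclidean similarity, so it keeps the basis
    reduced ([qdotM], [minkowski_reduced_scale]), and it sends [a] to 1.  It
    descends to a homeomorphism of the tori, with inverse induced by right
    multiplication by [a].  In charts this map is locally [q |-> q * c + l] with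
    [l] constant, and such maps are slice regular because the constants stand
    on the right and the imaginary unit acts on the left
    ([locally_affine_slice_regular]). *)

(** * Completing primitive integer vectors to unimodular matrices *)

(** The Smith normal form of a row is a multiple [c] of the first row of a
    unimodular matrix; [c] divides every entry of the row, so it is a unit. *)
Lemma primitive_row_first (m : nat) (x : 'rV[int]_m.+1) :
  \big[gcdn/0%N]_i absz (x 0 i) = 1%N ->
  exists2 B : 'M[int]_m.+1, B \in unitmx & row 0 B = x.
Proof.
move=> gcdx; have [L uL [U uU [d _ xE]]] := int_Smith_normal_form x.
have rowU : x = (L 0 0 * d`_0) *: row 0 U.
  apply/rowP => i; rewrite [in LHS]xE !mxE (bigD1 ord0)//= big1 ?addr0.
    by rewrite !mxE big_ord1 !mxE eqxx mulr1n.
  move=> j j0; rewrite !mxE big_ord1 !mxE eq_sym (negbTE (_ : val j != 0%N)) //.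
  by rewrite mulr0n mulr0 mul0r.
set c := L 0 0 * d`_0 in rowU.
have c1 : (absz c %| 1)%N.
  rewrite -gcdx; apply: (big_ind (fun n => absz c %| n)%N) => //.
    by move=> a b ca cb; rewrite dvdn_gcd ca.
  by move=> i _; rewrite rowU !mxE abszM dvdn_mulr.
have uc : c \is a GRing.unit.
  by rewrite qualifE /=; move: c1; rewrite dvdn1; lia.
exists (c *: U); last by rewrite linearZ.
by rewrite unitmxZ.
Qed.

(** Prescribing the first rows of the identity amounts to a lower triangular
    block matrix, so that only the last block has to be completed. *)
Lemma primitive_row_completion (n : nat) (k : 'I_n) (x : 'rV[int]_n) :
  \big[gcdn/0%N]_(i < n | (k <= i)%N) absz (x 0 i) = 1%N ->
  exists B : 'M[int]_n, [/\ B \in unitmx,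
    forall i : 'I_n, (i < k)%N -> row i B = delta_mx 0 i & row k B = x].
Proof.
case: k => k kn; have [m nE] : exists m, n = (k + m.+1)%N.
  by exists (n - k.+1)%N; lia.
subst n => /=.
rewrite big_split_ord /= big_pred0 ?gcd0n; last first.
  by move=> i /=; rewrite leqNgt ltn_ord.
move=> gcdx; have [|C uC Cx] := @primitive_row_first m (rsubmx x).
  rewrite -[RHS]gcdx; apply: eq_big => [i|i _]; first by rewrite leq_addr.
  by rewrite mxE.
exists (block_mx 1%:M 0 (delta_mx 0 0 *m lsubmx x) C); split.
- by rewrite unitmxE det_lblock det1 mul1r -unitmxE.
- move=> i ik; rewrite (_ : i = lshift m.+1 (Ordinal ik)); last exact: val_inj.
  rewrite rowKu; apply/rowP => j; rewrite !mxE.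
  case: splitP => j' jj'; rewrite !mxE ?eqxx -?val_eqE /= jj' //.
    by rewrite eq_sym.
  by rewrite gtn_eqF // (leq_trans ik) // leq_addr.
- rewrite (_ : Ordinal kn = rshift k ord0); last first.
    by apply: val_inj; rewrite /= addn0.
  rewrite rowKd -[RHS](hsubmxK x) -[in RHS]Cx row_row_mx row_mul.
  rewrite (_ : row 0 (delta_mx 0 0) = 1%:M) ?mul1mx //.
  by apply/rowP => j; rewrite !mxE !ord1 !eqxx.
Qed.

(** * Successive minima over the unimodular matrices *)

(** A minimizer over [P] can be searched among the finitely many vectors whose
    value does not exceed the one at [x0]. *)
Lemma coercive_min (R : realType) (n : nat) (f : 'rV[int]_n -> R)
    (P : 'rV[int]_n -> Prop) (x0 : 'rV[int]_n) :
  (forall b, exists N : nat, forall x, f x <= b ->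
     forall i, (absz (x 0%R i) <= N)%N) ->
  P x0 -> exists2 x, P x & forall y, P y -> f x <= f y.
Proof.
move=> fN Px0; have [N bN] := fN (f x0).
(* Through [g] the box of entries at most [N] is the image of a finite type. *)
pose g (t : 'rV['I_(N + N).+1]_n) : 'rV[int]_n :=
  map_mx (fun k : 'I_(N + N).+1 => k%:Z - N%:Z) t.
have gP y : f y <= f x0 -> exists t, g t = y.
  move=> /bN yN; exists (map_mx (fun z => inord (absz (z + N%:Z))) y).
  apply/rowP => i; rewrite !mxE inordK; move: (yN i).
    by case: (y 0 i) => z; lia.
  by case: (y 0 i) => z; lia.
have [t0 gt0] := gP x0 (lexx _).
have Pt0 : `[< P (g t0) >] by apply/asboolP; rewrite gt0.
case: (@arg_minP _ _ _ t0 (fun t => `[< P (g t) >]) (fun t => f (g t)) Pt0).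
move=> t /asboolP Pt tmin; exists (g t) => // y Py.
have [yx0|x0y] := leP (f y) (f x0).
  have [u uy] := gP y yx0.
  by rewrite -uy; apply: tmin; rewrite uy; apply/asboolP.
by apply: le_trans (ltW x0y); rewrite -gt0; exact: tmin.
Qed.

(** The competitors of a row are the rows that can follow the previous ones in
    a unimodular matrix. *)
Definition successively_minimal (R : realType) (n : nat)
    (f : 'rV[int]_n -> R) (A : 'M[int]_n) : Prop :=
  A \in unitmx /\ forall (k : 'I_n) (B : 'M[int]_n), B \in unitmx ->
    (forall i : 'I_n, (i < k)%N -> row i B = row i A) ->
    f (row k A) <= f (row k B).

(** Rows are optimized in order: a later choice keeps the earlier rows, hence
    also their minimality. *)
Lemma successively_minimal_exists (R : realType) (n : nat)
    (f : 'rV[int]_n -> R) :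
  (forall b, exists N : nat, forall x, f x <= b ->
     forall i, (absz (x 0%R i) <= N)%N) ->
  exists A, successively_minimal f A.
Proof.
move=> fN.
suff: forall m, exists A : 'M[int]_n, A \in unitmx /\
    forall k : 'I_n, (k < m)%N -> forall B : 'M[int]_n, B \in unitmx ->
    (forall i : 'I_n, (i < k)%N -> row i B = row i A) ->
    f (row k A) <= f (row k B).
  by move=> /(_ n)[A [uA Amin]]; exists A; split=> // k; exact: Amin.
elim=> [|m [A [uA Amin]]]; first by exists 1%:M; rewrite unitmx1.
have [mn|nm] := ltnP m n; last first.
  by exists A; split=> // k _; apply: Amin; exact: leq_trans (ltn_ord k) nm.
pose P x := exists2 B : 'M[int]_n, B \in unitmx &
  (forall i : 'I_n, (i < m)%N -> row i B = row i A) /\ row (Ordinal mn) B = x.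
have [|x [A' uA' [A'A A'x]] xmin] :=
    @coercive_min _ _ f P (row (Ordinal mn) A) fN.
  by exists A.
exists A'; split=> // k; rewrite ltnS leq_eqVlt => /predU1P[km|km] B uB BA'.
  have -> : k = Ordinal mn by exact: val_inj.
  rewrite A'x; apply: xmin; exists B => //; split=> // i im.
  by rewrite -A'A // BA' // km.
rewrite A'A //; apply: Amin => // i ik; rewrite BA' // A'A //.
exact: ltn_trans km.
Qed.

(** The content of Minkowski's condition B2: with a primitive tail, [x *m A] can
    follow the rows of [A] before the k-th one in a unimodular matrix. *)
Lemma successively_minimal_primitive (R : realType) (n : nat)
    (f : 'rV[int]_n -> R) (A : 'M[int]_n) (k : 'I_n) (x : 'rV[int]_n) :
  successively_minimal f A ->
  \big[gcdn/0%N]_(i < n | (k <= i)%N) absz (x 0 i) = 1%N ->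
  f (row k A) <= f (x *m A).
Proof.
move=> [uA Amin] /primitive_row_completion[B [uB Bid Bx]].
rewrite -Bx -row_mul; apply: Amin; first by rewrite unitmx_mul uB.
by move=> i ik; rewrite row_mul Bid // -rowE.
Qed.

Lemma row_signs (n : nat) (s : 'I_n -> int) (A : 'M[int]_n) (i : 'I_n) :
  row i (diag_mx (\row_j s j) *m A) = s i *: row i A.
Proof. by apply/rowP => j; rewrite mul_diag_mx !mxE. Qed.

(** Sign changes permute the competitors of each row and preserve [f]. *)
Lemma successively_minimal_signs (R : realType) (n : nat)
    (f : 'rV[int]_n -> R) (s : 'I_n -> int) (A : 'M[int]_n) :
  (forall x, f (- x) = f x) -> (forall i, s i = 1 \/ s i = -1) ->
  successively_minimal f A ->
  successively_minimal f (diag_mx (\row_j s j) *m A).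
Proof.
move=> fN s1 [uA Amin].
have fs i x : f (s i *: x) = f x.
  by case: (s1 i) => ->; rewrite ?scale1r ?scaleN1r ?fN.
have ss i : s i * s i = 1 by case: (s1 i) => ->.
set D := diag_mx _.
have DD : D *m D = 1%:M.
  apply/row_matrixP => i; rewrite row_signs; apply/rowP => j.
  rewrite !mxE -val_eqE /=; case: eqP => _; first exact: ss.
  by rewrite mulr0.
have uD : D \in unitmx by have [] := mulmx1_unit DD.
split=> [|k B uB BA]; first by rewrite unitmx_mul uD.
rewrite row_signs fs -(fs k (row k B)) -row_signs.
apply: Amin => [|i ik]; first by rewrite unitmx_mul uD.
by rewrite row_signs BA // row_signs scalerA ss scale1r.
Qed.

(** The sign of each index is chosen after that of its predecessor, so that
    their product makes the entry nonnegative. *)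
Lemma consecutive_signs (R : realDomainType) (n : nat) (r : 'M[R]_n) :
  exists2 s : 'I_n -> int, forall i, s i = 1 \/ s i = -1 &
    forall k l : 'I_n, l = k.+1 :> nat -> 0 <= r k l *~ (s k * s l).
Proof.
case: n r => [|n] r; first by exists (fun=> 1) => [i|k]; [left|case: k].
pose t := fix t (m : nat) : int := if m is m'.+1 then
  t m' * (if 0 <= r (inord m') (inord m) then 1 else -1) else 1.
have t1 m : t m = 1 \/ t m = -1.
  by elim: m => [|m IH] /=; [left|case: IH => ->; case: ifP => _; auto].
exists (fun i : 'I_n.+1 => t i) => // k l lk.
rewrite lk /= -lk !inord_val mulrA.
have -> : t k * t k = 1 by case: (t1 k) => ->.
rewrite mul1r; case: ifPn => [//|]; rewrite -ltNge => /ltW.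
by rewrite mulrN1z oppr_ge0.
Qed.

(** * Minkowski reduction of a basis *)

Definition combination (R : realType) (v : 'I_4 -> quat R) (x : 'rV[int]_4) :
    quat R :=
  \sum_(j < 4) v j *~ x 0 j.

Definition coord_mx (R : realType) (v : 'I_4 -> quat R) : 'M[R]_4 :=
  \matrix_(i, j) v i 0 j.

Lemma combinationE (R : realType) (v : 'I_4 -> quat R) (x : 'rV[int]_4) :
  combination v x = map_mx intr x *m coord_mx v :> 'rV[R]_4.
Proof.
apply/rowP => m; rewrite /combination summxE mxE; apply: eq_bigr => j _.
by rewrite -scaler_int !mxE.
Qed.

Lemma combination_row (R : realType) (v : 'I_4 -> quat R) (A : 'M[int]_4)
    (x : 'rV[int]_4) :
  combination (fun i => combination v (row i A)) x = combination v (x *m A).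
Proof.
rewrite !combinationE map_mxM -mulmxA; congr (_ *m _).
apply/row_matrixP => i; rewrite row_mul -map_row -combinationE.
by apply/rowP => j; rewrite !mxE.
Qed.

Lemma combinationN (R : realType) (v : 'I_4 -> quat R) (x : 'rV[int]_4) :
  combination v (- x) = - combination v x.
Proof.
by rewrite /combination -sumrN; apply: eq_bigr => j _; rewrite mxE mulrNz.
Qed.

Lemma combinationZ (R : realType) (v : 'I_4 -> quat R) (s : int)
    (x : 'rV[int]_4) :
  combination v (s *: x) = combination v x *~ s.
Proof.
rewrite /combination mulrz_suml; apply: eq_bigr => j _.
by rewrite mxE mulrC -mulrzA.
Qed.

Lemma qdot_mx (R : realType) (p q : quat R) :
  qdot p q = ((p : 'rV[R]_4) *m (q : 'rV[R]_4)^T) 0 0.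
Proof. by rewrite mxE; apply: eq_bigr => m _; rewrite mxE. Qed.

Lemma gram_form (R : realType) (v : 'I_4 -> quat R) (n : 'rV[int]_4) :
  ((map_mx intr n : 'rV[R]_4) *m gram v *m (map_mx intr n)^T) 0 0 =
  qdot (combination v n) (combination v n).
Proof.
have -> : gram v = coord_mx v *m (coord_mx v)^T.
  by apply/matrixP => i j; rewrite !mxE; apply: eq_bigr => m _; rewrite !mxE.
by rewrite qdot_mx !combinationE trmx_mul !mulmxA.
Qed.

Lemma qdotMz (R : realType) (p q : quat R) (s t : int) :
  qdot (p *~ s) (q *~ t) = qdot p q *~ (s * t).
Proof.
have coordMz (r : quat R) z m : (r *~ z) 0 m = r 0 m *~ z.
  by rewrite -[r *~ z]scaler_int mxE mulrzl.
rewrite /qdot mulrz_suml; apply: eq_bigr => m _.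
by rewrite !coordMz mulrzAl mulrzAr mulrzA mulrzAC.
Qed.

(** Right multiplication is a Euclidean similarity: this is the polarized form
    of the multiplicativity of the norm. *)
Lemma qdotM (R : realType) (p q c : quat R) :
  qdot (p * c) (q * c) = qdot c c * qdot p q.
Proof. by rewrite !qmulE !qdotE /qmul !quat_ofE; ring. Qed.

Lemma free_combination (R : realType) (v : 'I_4 -> quat R) :
  free [tuple v i | i < 4] <->
  forall k : 'rV[R]_4, k *m coord_mx v = 0 -> k = 0.
Proof.
have E (k : 'I_4 -> R) : \sum_(i < 4) k i *: [tuple v i | i < 4]`_i =
    (\row_i k i) *m coord_mx v :> 'rV[R]_4.
  apply/rowP => m; rewrite summxE mxE; apply: eq_bigr => j _.
  by rewrite -tnth_nth tnth_mktuple !mxE.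
split=> [/freeP fv k kv|fv].
  apply/rowP => i; rewrite mxE; apply: (fv (fun i => k 0 i)).
  rewrite E -[RHS]kv; congr (_ *m _).
  by apply/rowP => j; rewrite mxE.
apply/freeP => k; rewrite E => /fv /rowP k0 i.
by have := k0 i; rewrite !mxE.
Qed.

Lemma free_coord_unitmx (R : realType) (v : 'I_4 -> quat R) :
  free [tuple v i | i < 4] -> coord_mx v \in unitmx.
Proof.
by move=> /free_combination fv; rewrite -row_free_unit; exact: inj_row_free.
Qed.

(** Coordinates are linear functions of the vector, namely the columns of the
    inverse of the coordinate matrix, so a bound on the vector bounds them. *)
Lemma combination_coercive (R : realType) (v : 'I_4 -> quat R) :
  free [tuple v i | i < 4] ->
  forall b : R, exists N : nat, forall x : 'rV[int]_4,
    qdot (combination v x) (combination v x) <= b ->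
    forall i, (absz (x 0%R i) <= N)%N.
Proof.
move=> /free_coord_unitmx uV b.
pose W := invmx (coord_mx v).
pose C : R := (b + 1) * \sum_i \sum_j `|W i j|.
exists (Num.bound `|C|) => x xb i.
set q := combination v x in xb.
(* [t ^+ 2 <= b] gives [`|t| <= b + 1] without a square root. *)
have qm m : `|q 0 m| <= b + 1.
  have : q 0 m ^+ 2 <= b.
    apply: le_trans xb; rewrite /qdot (bigD1 m) //= -expr2 lerDl.
    by apply: sumr_ge0 => j _; rewrite -expr2 sqr_ge0.
  rewrite -real_normK ?num_real // => h.
  have := normr_ge0 (q 0 m); nra.
have b0 : 0 <= b + 1 := le_trans (normr_ge0 _) (qm 0).
have xE : (x 0 i)%:~R = \sum_m q 0 m * W m i.
  have : map_mx intr x = (q : 'rV[R]_4) *m W.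
    by rewrite /q combinationE mulmxK.
  by move=> /rowP/(_ i); rewrite !mxE.
have : `|(x 0 i)%:~R| <= `|C|.
  rewrite xE [leRHS]ger0_norm; last first.
    by rewrite mulr_ge0 // !sumr_ge0 // => ? _; rewrite sumr_ge0.
  apply: le_trans (ler_norm_sum _ _ _) _.
  rewrite /C mulr_sumr; apply: ler_sum => m _; rewrite normrM.
  apply: ler_pM => //; rewrite (bigD1 i) //= lerDl sumr_ge0 //.
move=> /le_lt_trans /(_ (archi_boundP (normr_ge0 _))).
rewrite -intr_norm -[X in _ < X]/((Num.bound `|C|)%:~R) ltr_int; lia.
Qed.

Lemma reduced_combination_exists (R : realType) (v : 'I_4 -> quat R) :
  free [tuple v i | i < 4] ->
  exists2 A : 'M[int]_4, A \in unitmx &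
    minkowski_reduced (gram (fun i => combination v (row i A))).
Proof.
move=> fv; pose f x := qdot (combination v x) (combination v x).
have [A Amin] :=
  @successively_minimal_exists _ _ f (combination_coercive fv).
have [s s1 sr] :=
  consecutive_signs (gram (fun i => combination v (row i A))).
have fN x : f (- x) = f x.
  by rewrite /f combinationN -mulrN1z qdotMz.
have Dmin := successively_minimal_signs fN s1 Amin.
exists (diag_mx (\row_j s j) *m A); first by case: Dmin.
split=> [k l lk|k n n1 /=].
  by have := sr k l lk; rewrite !mxE !row_signs !combinationZ qdotMz.
rewrite gram_form combination_row mxE.
exact: (successively_minimal_primitive Dmin).
Qed.

Lemma minkowski_reduced_scale (R : realType) (a : R) (G : 'M[R]_4) :
  0 <= a -> minkowski_reduced G -> minkowski_reduced (a *: G).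
Proof.
move=> a0 [B1 B2]; split=> [k l lk|k n n1 /=].
  by rewrite mxE mulr_ge0 ?B1.
rewrite -scalemxAr -scalemxAl [leLHS]mxE [leRHS]mxE ler_wpM2l //.
exact: B2.
Qed.

Lemma gramM (R : realType) (v : 'I_4 -> quat R) (c : quat R) :
  gram (fun i => v i * c) = qdot c c *: gram v.
Proof. by apply/matrixP => i j; rewrite !mxE qdotM. Qed.

Lemma qdot_ge0 (R : realType) (c : quat R) : 0 <= qdot c c.
Proof. by apply: sumr_ge0 => m _; rewrite -expr2 sqr_ge0. Qed.

(** * Bases of lattices *)

Lemma lattice_spanP (R : realType) (v : 'I_4 -> quat R) (q : quat R) :
  lattice_span v q <-> exists x, q = combination v x.
Proof.
split=> [[n ->]|[x ->]]; last by exists (fun i => x 0 i).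
by exists (\row_i n i); apply: eq_bigr => i _; rewrite mxE.
Qed.

Lemma is_basis_unitmx (R : realType) (L : set (quat R)) (v : 'I_4 -> quat R)
    (A : 'M[int]_4) :
  A \in unitmx -> is_basis L v -> is_basis L (fun i => combination v (row i A)).
Proof.
move=> uA [/free_combination fv ->]; split.
  apply/free_combination => k.
  have -> : coord_mx (fun i => combination v (row i A)) =
      map_mx intr A *m coord_mx v.
    apply/row_matrixP => i; rewrite row_mul -map_row -combinationE.
    by apply/rowP => j; rewrite !mxE.
  rewrite mulmxA => /fv kA.
  have uA' : (map_mx intr A : 'M[R]_4) \in unitmx.
    by rewrite unitmxE det_map_mx rmorph_unit // -unitmxE.
  by rewrite -[k](mulmxK uA') kA mul0mx.
apply/seteqP; split=> q /lattice_spanP[x ->]; apply/lattice_spanP.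
  by exists (x *m invmx A); rewrite combination_row mulmxKV.
by exists (x *m A); rewrite combination_row.
Qed.

Lemma combinationM (R : realType) (v : 'I_4 -> quat R) (c : quat R)
    (x : 'rV[int]_4) :
  combination (fun i => v i * c) x = combination v x * c.
Proof.
by rewrite /combination mulr_suml; apply: eq_bigr => i _; rewrite mulrzAl.
Qed.

Lemma is_basisM (R : realType) (L : set (quat R)) (v : 'I_4 -> quat R)
    (c : quat R) : c != 0 -> is_basis L v ->
  is_basis [set q * c | q in L] (fun i => v i * c).
Proof.
move=> c0 [/freeP fv ->]; have uc : c \is a GRing.unit by rewrite unfold_in.
split.
  apply/freeP => k kv; apply: fv; apply: (mulIr uc).
  rewrite mul0r -[RHS]kv mulr_suml; apply: eq_bigr => i _.
  by rewrite -!tnth_nth !tnth_mktuple -scalerAl.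
apply/seteqP; split=> q.
  move=> [p /lattice_spanP[x ->] <-]; apply/lattice_spanP.
  by exists x; rewrite combinationM.
move=> /lattice_spanP[x ->]; rewrite combinationM.
exists (combination v x) => //.
by apply/lattice_spanP; exists x.
Qed.

(** * Tori *)

Lemma torus_projP (R : realType) (L : lattice R) (p q : quat R) :
  torus_proj L p = torus_proj L q <-> lattice_set L (p - q).
Proof.
(* [torus L] is a copy of the quotient of the additive group by [L]. *)
rewrite -[torus_proj L p = _]/(
  \pi_(ring_quotient.Quotient.quot (lattice_mem L)) p =
  \pi_(ring_quotient.Quotient.quot (lattice_mem L)) q).
split=> [/eqP|/asboolP Lpq].
  by rewrite -Quotient.idealrBE => /asboolP.
by apply/eqP; rewrite -Quotient.idealrBE.
Qed.

Lemma torus_proj_continuous (R : realType) (L : lattice R) :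
  continuous (torus_proj L).
Proof. exact: pi_continuous. Qed.

(** The map of tori induced by right multiplication by [c], given on the chosen
    representatives; it is independent of them when [c] maps [L1] into [L2]. *)
Definition torus_map (R : realType) (L1 L2 : lattice R) (c : quat R) :
    torus L1 -> torus L2 :=
  fun x => torus_proj L2 (repr x * c).

Lemma qmulr_continuous (R : realType) (c : quat R) :
  continuous (fun q : quat R => q * c).
Proof.
have -> : (fun q : quat R => q * c) =
    fun q => \sum_(m < 4) q 0 m *: ((delta_mx 0 m : quat R) * c).
  apply/funext => q; rewrite [in LHS](row_sum_delta q) mulr_suml.
  by apply: eq_bigr => m _; rewrite scalerAl.
apply: continuous_big => [|m _ q]; first exact: add_continuous.
exact: (cvgZr_tmp (@coord_continuous R 1 4 0 m q)).
Qed.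

Lemma torus_map_proj (R : realType) (L1 L2 : lattice R) (c : quat R) q :
  (forall q, lattice_set L1 q -> lattice_set L2 (q * c)) ->
  torus_map L2 c (torus_proj L1 q) = torus_proj L2 (q * c).
Proof.
move=> L12; apply/torus_projP; rewrite -mulrBl; apply: L12.
by apply/torus_projP; rewrite /torus_proj reprK.
Qed.

(** The difference quotients are constant, so that the existence of the
    directional derivative does not require continuity. *)
Lemma is_derive_affine (R : realType) (V W : normedModType R) (f : V -> W)
    (a v : V) (w : W) :
  (forall t : R, f (t *: v + a) = t *: w + f a) -> is_derive a v f w.
Proof.
move=> fE.
have fw : (fun h => h^-1 *: (f (h *: v + a) - f a)) @ 0^' --> w.
  apply: (@cvg_near_cst _ _ w); near=> h.
  rewrite fE addrK scalerA mulVf ?scale1r //.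
  by near: h; exact: nbhs_dnbhs_neq.
by split; [exact: cvgP fw|exact: cvg_lim fw].
Unshelve. all: by end_near. Qed.

Lemma slice_pt_continuous (R : realType) (I : quat R) : continuous (slice_pt I).
Proof.
have -> : slice_pt I = fun z : R * R => z.1 *: 1 + z.2 *: I.
  by apply/funext => z; rewrite /slice_pt -scalerAr mulr1.
by move=> z; apply: cvgD; apply: cvgZr_tmp; [exact: cvg_fst|exact: cvg_snd].
Qed.

(** An affine map [q |-> q * c + l] is slice regular because its derivatives
    along 1 and [I] are [c] and [I * c], and [I * I = -1]. *)
Lemma locally_affine_slice_regular (R : realType) (Om : set (quat R))
    (f : quat R -> quat R) (c : quat R) :
  (forall q, Om q -> exists l, \forall p \near q, f p = p * c + l) ->
  slice_regular Om f.
Proof.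
move=> faff I I2 fI dx dy z /faff[l fl].
pose aff y := slice_pt I y * c + l.
have fIl : \forall y \near z, aff y = fI y.
  have : \forall y \near z, fI y = aff y := slice_pt_continuous fl.
  by apply: filterS.
have affE t y v : aff (t *: v + y) = t *: (slice_pt I v * c) + aff y.
  rewrite /aff addrA; congr (_ + _); rewrite scalerAl -mulrDl; congr (_ * _).
  rewrite /slice_pt /= !scalerDl -!scalerA mulrDr scalerDr -!scalerAr.
  by rewrite addrACA.
have dxE y : (\near y, aff y = fI y) ->
    is_derive y (1, 0) fI c /\ is_derive y (0, 1) fI (I * c).
  move=> fy; split; apply: (near_eq_is_derive fy); apply: is_derive_affine => t.
    by rewrite affE /slice_pt /= scale0r mulr0 addr0 scale1r mul1r.
  by rewrite affE /slice_pt /= scale0r add0r scale1r mulr1.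
(* The equality with [aff] propagates to a neighbourhood of each nearby point,
   so the partial derivatives are constant near [z]. *)
have dE : \forall z' \near z, dx z' = c /\ dy z' = I * c.
  move: fIl => /near_join; apply: filterS => z' /dxE[d1 d2].
  by split; exact: derive_val.
have [dxz dyz] := nbhs_singleton dE; have [[d1 _] [d2 _]] := dxE _ fIl.
split.
- by split.
- by apply: cvg_near_cst; apply: filterS dE => y [-> _].
- by apply: cvg_near_cst; apply: filterS dE => y [_ ->].
by rewrite dxz dyz mulrA -expr2 I2 mulN1r subrr scaler0.
Qed.

Lemma torus_map_regular (R : realType) (L1 L2 : lattice R) (c : quat R) :
  (forall q, lattice_set L1 q -> lattice_set L2 (q * c)) ->
  torus_regular (@torus_map R L1 L2 c).
Proof.
move=> L12; have FE q := torus_map_proj q L12.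
split.
  apply/quotient_continuous.
  rewrite (_ : _ \o _ = torus_proj L2 \o (fun q => q * c)).
    move=> q; apply: continuous_comp; first exact: qmulr_continuous.
    exact: torus_proj_continuous.
  by apply/funext => q; exact: FE.
move=> U V _ [oV _ injV].
apply: (locally_affine_slice_regular (c := c)) => q [_ [q' Vq' q'q]].
(* Near [q] the lift of the map with values in [V] is the translate of
   [p |-> p * c] that sends [q] to [q']; it stays in [V] by continuity. *)
exists (q' - q * c).
have chartK p : V p -> chart V (torus_proj L2 p) = p.
  by move=> Vp; rewrite /chart (pinvKV _ injV) ?inE.
have : \forall p \near q, V (p * c + (q' - q * c)).
  have cq : p * c + (q' - q * c) @[p --> q] --> q'.
    rewrite -[X in _ --> X](subrKC (q * c)).
    exact: (cvgD (@qmulr_continuous R c q) (cvg_cst _)).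
  by apply: cq; exact: open_nbhs_nbhs.
apply: filterS => p Vp; rewrite /= FE -(chartK _ Vp); congr (chart V _).
(* The two points differ by [q * c - q'], a lattice vector. *)
apply/torus_projP; rewrite opprD addrA subrr sub0r opprB.
by apply/torus_projP; rewrite -FE q'q.
Qed.

Lemma torus_map_cancel (R : realType) (L1 L2 : lattice R) (c d : quat R) :
  (forall q, lattice_set L1 q -> lattice_set L2 (q * c)) ->
  (forall q, lattice_set L2 q -> lattice_set L1 (q * d)) -> c * d = 1 ->
  cancel (@torus_map R L1 L2 c) (@torus_map R L2 L1 d).
Proof.
move=> L12 L21 cd x; rewrite -[x]reprK -[\pi_(_) _]/(torus_proj L1 (repr x)).
by rewrite !torus_map_proj // -mulrA cd mulr1.
Qed.

(** Right multiplications by [c] and by its inverse induce inverse maps. *)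
Lemma tori_equivM (R : realType) (L1 L2 : lattice R) (c : quat R) :
  c != 0 -> L2 = [set q * c | q in L1] :> set _ -> tori_equiv L1 L2.
Proof.
move=> c0 L2E; have uc : c \is a GRing.unit by rewrite unfold_in.
have L12 q : lattice_set L1 q -> lattice_set L2 (q * c).
  by rewrite L2E => L1q; exists q.
have L21 q : lattice_set L2 q -> lattice_set L1 (q * c^-1).
  by rewrite L2E => -[p L1p <-]; rewrite mulrK.
exists (@torus_map R L1 L2 c); split; first exact: torus_map_regular.
exists (@torus_map R L2 L1 c^-1); split.
- by apply: torus_map_cancel => //; rewrite divrr.
- by apply: torus_map_cancel => //; rewrite mulVr.
- exact: torus_map_regular.
Qed.

(** * Equivalence with a special basis *)

Theorem theorem6p11 (R : realType) (L1 : lattice R) (v : 'I_4 -> quat R)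
    (hv : is_basis L1 v) :
  exists (L2 : lattice R) (w : 'I_4 -> quat R),
    [/\ special_basis L2 w, basis_equiv v w, lattice_equiv L1 L2 &
        tori_equiv L1 L2].
Proof.
have [A uA redA] := reduced_combination_exists hv.1.
set u := fun i => _ in redA; have ub : is_basis L1 u := is_basis_unitmx uA hv.
set a := u ord0; have a0 : a != 0.
  apply: (free_not0 ub.1); rewrite -[a](tnth_mktuple u ord0); exact: mem_tnth.
have ua : a \is a GRing.unit by rewrite unfold_in.
have va0 : a^-1 != 0 by rewrite invr_eq0.
pose w i := u i * a^-1.
have wb := is_basisM va0 ub.
pose L2 := Lattice (ex_intro _ w wb).
have tL : tori_equiv L1 L2 by exact: (@tori_equivM R L1 L2 _ va0 erefl).
exists L2, w; split=> //.
  split; [exact: (is_basisM va0 ub)| |by rewrite /w divrr].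
  by rewrite /w gramM; apply: minkowski_reduced_scale redA; exact: qdot_ge0.
exists a, A; split=> // i; rewrite /w divrK //.
by apply: eq_bigr => j _; rewrite mxE.
Qed.
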